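(* Suppose $\mathbb K$ is a computable age with the joint embedding property (JEP). Then $\mathbb K$ also has the $\mathscr{EI}(\mathbb K)$-computable joint embedding property; that is, there is a function $f$ with domain $\mathbb K\times\mathbb K$, computable from the embedding information $\mathscr{EI}(\mathbb K)$, such that for all $\mathbb I(\ell_0),\mathbb I(\ell_1)\in\mathbb K$ we have $f(\mathbb I(\ell_0),\mathbb I(\ell_1))=(F_0,F_1)$ where $F_0$ and $F_1$ are embeddings in $\mathbb K$, $\mathrm{dom}(F_0)=\mathbb I(\ell_0)$, $\mathrm{dom}(F_1)=\mathbb I(\ell_1)$, and $\mathrm{codom}(F_0)=\mathrm{codom}(F_1)$.
   Context: Languages and structures. $\mathcal{L}$ is a countable language (relation symbols of positive arity; function symbols of any arity, 0-ary ones being constants) with a computable representation: relation symbols $R_n$ and function symbols $F_m$ are indexed bijectively by disjoint computable subsets of $\omega$, with arity computable from the index. An $\mathcal{L}$-structure $\mathcal{M}$ is c.e. if its underlying set $M$ is a c.e. subset of $\omega$ and the sets $\{(n,\mathbf a): \mathcal M\models R_n(\mathbf a)\}$, $\{(n,\mathbf a): \mathcal M\models \neg R_n(\mathbf a)\}$, $\{(m,\mathbf a,b): \mathcal M\models F_m(\mathbf a)=b\}$ are c.e.; it is computable if moreover $M$ is computable. Tuples are finite; $\mathrm{cl}_{\mathcal M}(\mathbf a)$ is the smallest substructure of $\mathcal M$ containing $\mathbf a$. For $\mathbf a\in\mathcal A$, $\mathbf b\in\mathcal B$ of the same length, $\mathbf a\simeq\mathbf b$ means that for every atomic $\mathcal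 L$-formula $\varphi$, $\mathcal A\models\varphi(\mathbf a)$ iff $\mathcal B\models\varphi(\mathbf b)$; equivalently $\mathbf a\mapsto\mathbf b$ extends to an isomorphism $\mathrm{cl}(\mathbf a)\to\mathrm{cl}(\mathbf b)$. Ages. An age is a collection of finitely generated $\mathcal L$-structures closed under isomorphism. A computable age (computable representation of an age $\mathcal K$) is a c.e. set $\mathbb K$ of triples $(\mathbf a,\mathcal A,i)$ (computable structures being given by indices), with exactly one triple for each $i\in\omega$, written $\mathbb I(i)=(\mathbf a_i,\mathcal A_i,i)$, such that each $\mathcal A_i$ is a computable $\mathcal L$-structure in $\mathcal K$ with $\mathcal A_i=\mathrm{cl}_{\mathcal A_i}(\mathbf a_i)$, and every $\mathcal B\in\mathcal K$ is isomorphic to some $\mathcal A_i$. $\mathbb K$ is said to have a property of ages if $\mathcal K$ does. The embedding information $\mathscr{EI}(\mathbb K)$ is the set of tuples $(\mathbb I(k_0),\mathbf b_0,\mathbb I(k_1),\mathbf b_1)$ with $\mathbf b_0\in\mathcal A_{k_0}$, $\mathbf b_1\in\mathcal A_{k_1}$ and $\mathbf b_0\simeq\mathbf b_1$. A potential embedding in $\mathbb K$ is a triple $F=(\mathbb I(i),\mathbb I(j),\mathbf c)$ with $\mathbf c\in\mathcal A_j$ a tuple; $\mathrm{dom}(F)=\mathbb I(i)$, $\mathrm{codom}(F)=\mathbb I(j)$; it is an embedding if $\mathbf a_i\simeq\mathbf c$. (JEP): for all $\mathcal A,\mathcal B\in\mathcal K$ there is $\mathcal C\in\mathcal K$ for which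 there are embeddings $\mathcal A\to\mathcal C$ and $\mathcal B\to\mathcal C$. *)

(* Defs.v *)
From Stdlib Require Import Arith List Cantor.
From Stdlib Require Vector Fin.
Set Implicit Arguments.
Unset Strict Implicit.

Notation "<< x , y >>" := (Cantor.to_nat (x, y)) (at level 0, x, y at level 200).

(* Programs for partial functions nat -> nat; several arguments are passed
   through the Cantor pairing, which is why its projections are basic
   functions. *)
Inductive program : Type :=
| Zero | Succ | Fst | Snd | Query
| Pair (p q : program)
| Comp (p q : program)
| Prec (p q : program)
| Mu (p : program).

(* [eval O p x y]: with oracle [O], program [p] halts on [x] with output [y]. *)
Fixpoint eval (O : nat -> Prop) (p : program) (x y : nat) {struct p} : Prop :=
  match p with
  | Zero => y = 0
  | Succ => y = S x
  | Fst => y = fst (Cantor.of_nat x)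
  | Snd => y = snd (Cantor.of_nat x)
  | Query => (O x /\ y = 1) \/ (~ O x /\ y = 0)
  | Pair p q => exists u v, eval O p x u /\ eval O q x v /\ y = <<u, v>>
  | Comp p q => exists z, eval O q x z /\ eval O p z y
  | Prec p q =>
      (* h(a, 0) = p(a),  h(a, n+1) = q(a, (n, h(a, n))) *)
      let a := fst (Cantor.of_nat x) in
      (fix h (n y : nat) {struct n} : Prop :=
         match n with
         | 0 => eval O p a y
         | S n => exists z, h n z /\ eval O q <<a, <<n, z>>>> y
         end) (snd (Cantor.of_nat x)) y
  | Mu p =>
      eval O p <<x, y>> 0 /\
      forall m, m < y -> exists k, eval O p <<x, m>> (S k)
  end.

Fixpoint code_program (p : program) : nat :=
  match p with
  | Zero => <<0, 0>>
  | Succ => <<1, 0>>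
  | Fst => <<2, 0>>
  | Snd => <<3, 0>>
  | Query => <<4, 0>>
  | Pair p q => <<5, <<code_program p, code_program q>>>>
  | Comp p q => <<6, <<code_program p, code_program q>>>>
  | Prec p q => <<7, <<code_program p, code_program q>>>>
  | Mu p => <<8, code_program p>>
  end.

Definition no_oracle (_ : nat) : Prop := False.

Definition decides (p : program) (S : nat -> bool) : Prop :=
  forall n, eval no_oracle p n (if S n then 1 else 0).

Definition semidecides (p : program) (S : nat -> Prop) : Prop :=
  forall n, S n <-> exists m, eval no_oracle p n m.

Definition computable_set (S : nat -> bool) : Prop := exists p, decides p S.

Definition ce_set (S : nat -> Prop) : Prop := exists p, semidecides p S.

(* The partial function with domain exactly [D] that agrees with [f] on [D] is
   computable from [O]; the values of [f] outside [D] are irrelevant. *)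
Definition computable_from (O : nat -> Prop) (X Y : Type)
    (codeX : X -> nat) (codeY : Y -> nat) (D : X -> Prop) (f : X -> Y) : Prop :=
  exists p, forall n m,
    eval O p n m <-> exists x, D x /\ codeX x = n /\ codeY (f x) = m.

Fixpoint code_list (s : list nat) : nat :=
  match s with
  | nil => 0
  | x :: s => S <<x, code_list s>>
  end.

(* A symbol is identified with its index. *)
Record language := Language {
  rel_index : nat -> bool;
  fun_index : nat -> bool;
  arity : nat -> nat;
  index_disjoint : forall n, rel_index n = true -> fun_index n = false;
  rel_arity_pos : forall n, rel_index n = true -> 0 < arity n;
  rel_index_computable : computable_set rel_index;
  fun_index_computable : computable_set fun_index;
  arity_computable :
    computable_from no_oracle (fun n : nat => n) (fun n : nat => n)
      (fun n => rel_index n = true \/ fun_index n = true) arity }.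

Definition rel_symbol (L : language) : Type := {n : nat | rel_index L n = true}.
Definition fun_symbol (L : language) : Type := {m : nat | fun_index L m = true}.

Definition rel_arity (L : language) (R : rel_symbol L) : nat :=
  arity L (proj1_sig R).
Definition fun_arity (L : language) (F : fun_symbol L) : nat :=
  arity L (proj1_sig F).

Record interpretation (L : language) (T : Type) := Interpretation {
  rel_interp : forall R : rel_symbol L, Vector.t T (rel_arity R) -> Prop;
  fun_interp : forall F : fun_symbol L, Vector.t T (fun_arity F) -> T }.

(* The carrier may be empty, as cl of the empty tuple is in a language without
   constants. *)
Record structure (L : language) := Structure {
  carrier :> Type;
  interp : interpretation L carrier }.

Definition rel (L : language) (A : structure L) (R : rel_symbol L) :
    Vector.t A (rel_arity R) -> Prop :=
  rel_interp (interp A) (R := R).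

Definition func (L : language) (A : structure L) (F : fun_symbol L) :
    Vector.t A (fun_arity F) -> A :=
  fun_interp (interp A) (F := F).

Definition embedding (L : language) (A B : structure L) (h : A -> B) : Prop :=
  (forall x y, h x = h y -> x = y) /\
  (forall (R : rel_symbol L) (v : Vector.t A (rel_arity R)),
     rel v <-> rel (Vector.map h v)) /\
  (forall (F : fun_symbol L) (v : Vector.t A (fun_arity F)),
     h (func v) = func (Vector.map h v)).

Definition isomorphic (L : language) (A B : structure L) : Prop :=
  exists h : A -> B, embedding h /\ forall y, exists x, h x = y.

Definition substructure (L : language) (A : structure L) (S : A -> Prop) : Prop :=
  forall (F : fun_symbol L) (v : Vector.t A (fun_arity F)),
    Vector.Forall S v -> S (func v).

Definition cl (L : language) (A : structure L) (a : list A) (x : A) : Prop :=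
  forall S : A -> Prop, substructure S -> Forall S a -> S x.

Definition generates (L : language) (A : structure L) (a : list A) : Prop :=
  forall x : A, cl a x.

Definition finitely_generated (L : language) (A : structure L) : Prop :=
  exists a : list A, generates a.

(* [n] is the number of variables, x_0, ..., x_{n-1}. *)
Inductive term (L : language) (n : nat) : Type :=
| Var (i : Fin.t n)
| App (F : fun_symbol L) (ts : Vector.t (term L n) (fun_arity F)).

Inductive atomic (L : language) (n : nat) : Type :=
| AEq (s t : term L n)
| ARel (R : rel_symbol L) (ts : Vector.t (term L n) (rel_arity R)).

Fixpoint value (L : language) (A : structure L) (n : nat) (a : Vector.t A n)
    (t : term L n) : A :=
  match t with
  | Var _ i => Vector.nth a i
  | App ts => func (Vector.map (value a) ts)
  end.

Definition sat (L : language) (A : structure L) (n : nat) (a : Vector.t A n)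
    (phi : atomic L n) : Prop :=
  match phi with
  | AEq s t => value a s = value a t
  | ARel ts => rel (Vector.map (value a) ts)
  end.

(* [n] is the common length of the two tuples. *)
Definition simeq (L : language) (A B : structure L) (a : list A) (b : list B) :
    Prop :=
  exists (n : nat) (u : Vector.t A n) (v : Vector.t B n),
    Vector.to_list u = a /\ Vector.to_list v = b /\
    forall phi : atomic L n, sat u phi <-> sat v phi.

Record nat_structure (L : language) := NatStructure {
  universe : nat -> bool;
  nat_interp : interpretation L {x : nat | universe x = true} }.

Definition to_structure (L : language) (A : nat_structure L) : structure L :=
  Structure (nat_interp A).
Coercion to_structure : nat_structure >-> structure.

Definition code_tuple (L : language) (A : nat_structure L) (a : list A) : nat :=
  code_list (map (@proj1_sig nat (fun x => universe A x = true)) a).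

Definition rel_graph (L : language) (A : nat_structure L) (n : nat) : Prop :=
  exists (R : rel_symbol L) (v : Vector.t A (rel_arity R)),
    n = <<proj1_sig R, code_tuple (Vector.to_list v)>> /\ rel v.

Definition neg_rel_graph (L : language) (A : nat_structure L) (n : nat) : Prop :=
  exists (R : rel_symbol L) (v : Vector.t A (rel_arity R)),
    n = <<proj1_sig R, code_tuple (Vector.to_list v)>> /\ ~ rel v.

Definition fun_graph (L : language) (A : nat_structure L) (n : nat) : Prop :=
  exists (F : fun_symbol L) (v : Vector.t A (fun_arity F)),
    n = <<proj1_sig F, <<code_tuple (Vector.to_list v), proj1_sig (func v)>>>>.

(* An index for [A] packs a decider of its universe and enumerators of its relations,
   their negations and its functions; [A] is computable if it has an index. *)
Definition structure_index (L : language) (A : nat_structure L) (e : nat) : Prop :=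
  exists pU pR pN pF : program,
    e = <<code_program pU, <<code_program pR, <<code_program pN, code_program pF>>>>>> /\
    decides pU (universe A) /\
    semidecides pR (rel_graph A) /\
    semidecides pN (neg_rel_graph A) /\
    semidecides pF (fun_graph A).

Record age (L : language) := Age {
  in_age :> structure L -> Prop;
  age_fg : forall A, in_age A -> finitely_generated A;
  age_iso : forall A B, in_age A -> isomorphic A B -> in_age B }.

Definition JEP (L : language) (K : age L) : Prop :=
  forall A B : structure L, K A -> K B ->
    exists C : structure L, K C /\
      (exists h : A -> C, embedding h) /\ (exists h : B -> C, embedding h).

(* A triple (a, A, i); [tr_index] is the index by which A is given, and only it
   (not A itself) enters the code of the triple. *)
Record triple (L : language) := Triple {
  tr_structure : nat_structure L;
  tr_tuple : list tr_structure;
  tr_index : nat;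
  tr_number : nat }.

Definition code_triple (L : language) (t : triple L) : nat :=
  <<code_tuple (tr_tuple t), <<tr_index t, tr_number t>>>>.

(* The set of triples is the range of [II]; by [II_number] it contains exactly
   one triple for each i. *)
Record computable_age (L : language) (K : age L) := ComputableAge {
  II : nat -> triple L;
  II_number : forall i, tr_number (II i) = i;
  II_index : forall i, structure_index (tr_structure (II i)) (tr_index (II i));
  II_ce : ce_set (fun n => exists i, n = code_triple (II i));
  II_in_age : forall i, K (tr_structure (II i));
  II_generated : forall i, generates (tr_tuple (II i));
  II_complete : forall B : structure L, K B ->
    exists i, isomorphic B (tr_structure (II i)) }.

Definition member (L : language) (K : age L) (KK : computable_age K)
    (t : triple L) : Prop :=
  exists i, t = II KK i.

Definition EI (L : language) (K : age L) (KK : computable_age K) (n : nat) : Prop :=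
  exists (k0 k1 : nat) (b0 : list (tr_structure (II KK k0)))
         (b1 : list (tr_structure (II KK k1))),
    n = <<code_triple (II KK k0),
          <<code_tuple b0, <<code_triple (II KK k1), code_tuple b1>>>>>> /\
    simeq b0 b1.

Record potential_embedding (L : language) := PotentialEmbedding {
  dom : triple L;
  codom : triple L;
  image : list (tr_structure codom) }.

Definition code_potential_embedding (L : language) (F : potential_embedding L) : nat :=
  <<code_triple (dom F), <<code_triple (codom F), code_tuple (image F)>>>>.

Definition is_embedding_in (L : language) (K : age L) (KK : computable_age K)
    (F : potential_embedding L) : Prop :=
  member KK (dom F) /\ member KK (codom F) /\ simeq (tr_tuple (dom F)) (image F).

Definition computable_JEP (L : language) (K : age L) (KK : computable_age K)
    (O : nat -> Prop) : Prop :=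
  exists f : triple L * triple L -> potential_embedding L * potential_embedding L,
    computable_from O
      (fun t => <<code_triple (fst t), code_triple (snd t)>>)
      (fun F => <<code_potential_embedding (fst F), code_potential_embedding (snd F)>>)
      (fun t => member KK (fst t) /\ member KK (snd t)) f /\
    forall l0 l1 : nat, exists F0 F1 : potential_embedding L,
      f (II KK l0, II KK l1) = (F0, F1) /\
      is_embedding_in KK F0 /\ is_embedding_in KK F1 /\
      dom F0 = II KK l0 /\ dom F1 = II KK l1 /\ codom F0 = codom F1.

(* Main.v *)
(** With oracle EI(K) one can decide whether a tuple c of A_k is the image of
    the generators a_l under an embedding A_l -> A_k, by asking whether
    (I(l), a_l, I(k), c) belongs to EI(K). Since a_l can be read off the code of
    I(l), an unbounded search over (I(k), c_0, c_1) finds embeddings of A_{l_0}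
    and A_{l_1} with common codomain: the JEP, together with the fact that every
    structure of the age is isomorphic to some A_k, makes the search succeed.
    Because EI(K) only mentions triples of K, the search diverges on every input
    that is not a pair of such triples. *)
Require Import Defs.
From Stdlib Require Import Arith List Cantor Wf_nat Eqdep_dec.
From Stdlib Require Import ClassicalEpsilon IndefiniteDescription.
From Stdlib Require Vector.
Set Implicit Arguments.
Unset Strict Implicit.

Arguments Cantor.to_nat : simpl never.
Arguments Cantor.of_nat : simpl never.

(** * Pairing and injectivity of codes *)

Definition pi1 (x : nat) : nat := fst (Cantor.of_nat x).
Definition pi2 (x : nat) : nat := snd (Cantor.of_nat x).

Lemma pi1_pair x y : pi1 <<x, y>> = x.
Proof. unfold pi1. now rewrite Cantor.cancel_of_to. Qed.

Lemma pi2_pair x y : pi2 <<x, y>> = y.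
Proof. unfold pi2. now rewrite Cantor.cancel_of_to. Qed.

Lemma pair_pi x : <<pi1 x, pi2 x>> = x.
Proof.
unfold pi1, pi2. rewrite <- surjective_pairing. apply Cantor.cancel_to_of.
Qed.

Lemma pair_inj x y x' y' : <<x, y>> = <<x', y'>> -> x = x' /\ y = y'.
Proof.
intros H. split.
- now rewrite <- (pi1_pair x y), H, pi1_pair.
- now rewrite <- (pi2_pair x y), H, pi2_pair.
Qed.

Lemma code_list_inj s t : code_list s = code_list t -> s = t.
Proof.
revert t. induction s as [|x s IH]; intros [|y t]; cbn; try discriminate; auto.
intros H. injection H as H. apply pair_inj in H as [-> H]. now rewrite (IH t H).
Qed.

(** * Programs that compute total functions *)

Section Programs.
Variable O : nat -> Prop.

(** The equivalence records totality and single-valuedness along with the value. *)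
Definition computes (p : program) (g : nat -> nat) : Prop :=
  forall x y, eval O p x y <-> y = g x.

Definition oracle_char (x : nat) : nat :=
  if excluded_middle_informative (O x) then 1 else 0.

Lemma computes_zero : computes Zero (fun _ => 0).
Proof. easy. Qed.

Lemma computes_succ : computes Succ S.
Proof. easy. Qed.

Lemma computes_fst : computes Fst pi1.
Proof. easy. Qed.

Lemma computes_snd : computes Snd pi2.
Proof. easy. Qed.

Lemma computes_query : computes Query oracle_char.
Proof.
intros x y; cbn; unfold oracle_char.
destruct (excluded_middle_informative (O x)); tauto.
Qed.

Lemma computes_pair p q g h :
  computes p g -> computes q h -> computes (Pair p q) (fun x => <<g x, h x>>).
Proof.
intros Hp Hq x y; cbn. split.
- intros (u & v & Hu & Hv & ->). now rewrite (proj1 (Hp _ _) Hu), (proj1 (Hq _ _) Hv).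
- intros ->. exists (g x), (h x). now rewrite (Hp x), (Hq x).
Qed.

Lemma computes_comp p q g h :
  computes p g -> computes q h -> computes (Comp p q) (fun x => g (h x)).
Proof.
intros Hp Hq x y; cbn. split.
- intros (z & Hz & Hy). now rewrite <- (proj1 (Hq _ _) Hz); apply Hp.
- intros ->. exists (h x). now rewrite (Hq x), (Hp (h x)).
Qed.

Lemma computes_prec p q g h :
  computes p g -> computes q h ->
  computes (Prec p q)
    (fun x => nat_rect _ (g (pi1 x)) (fun n z => h <<pi1 x, <<n, z>>>>) (pi2 x)).
Proof.
intros Hp Hq x. cbn. fold (pi1 x). fold (pi2 x).
induction (pi2 x) as [|n IH]; intros y; cbn.
- apply Hp.
- split.
  + intros (z & Hz & Hy). rewrite <- (proj1 (IH _) Hz). now apply Hq.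
  + intros ->. eexists. split; [apply IH; reflexivity|]. now apply Hq.
Qed.

(** As [p] halts everywhere, the convergence that [Mu] demands below [y] is automatic; only
    nonvanishing remains. *)
Lemma eval_mu p g x y :
  computes p g ->
  eval O (Mu p) x y <-> g <<x, y>> = 0 /\ forall m, m < y -> g <<x, m>> <> 0.
Proof.
intros Hp; cbn. rewrite (Hp _ 0). split.
- intros [H0 H]. split; [easy|]. intros m Hm. destruct (H m Hm) as [k Hk].
  apply Hp in Hk. now rewrite <- Hk.
- intros [H0 H]. split; [easy|]. intros m Hm. specialize (H m Hm).
  destruct (g <<x, m>>) as [|k] eqn:E; [easy|]. exists k. now apply Hp.
Qed.

(** * The search program and its semantics *)

Definition identity : program := Pair Fst Snd.

Lemma computes_identity : computes identity (fun x => x).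
Proof.
intros x y. rewrite <- (pair_pi x) at 2.
apply (computes_pair computes_fst computes_snd).
Qed.

(** [Mu] looks for a zero, so the test must vanish exactly when both oracle answers are 1. The outer
    recursion on [v] returns 1 at 0; at a successor the inner one tests [u] the same way. *)
Definition nand : program :=
  Prec (Comp Succ Zero)
    (Comp (Prec (Comp Succ Zero) Zero) (Pair Zero (Comp Fst identity))).

Lemma computes_nand :
  exists g, computes nand g /\ forall u v, g <<u, v>> = 0 <-> u <> 0 /\ v <> 0.
Proof.
eexists. split.
- apply computes_prec.
  + exact (computes_comp computes_succ computes_zero).
  + apply computes_comp.
    * exact (computes_prec (computes_comp computes_succ computes_zero) computes_zero).
    * apply computes_pair; [exact computes_zero|].
      exact (computes_comp computes_fst computes_identity).
- intros u v. cbn beta. rewrite pi1_pair, !pi2_pair.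
  destruct v; cbn; [easy|]. rewrite pi2_pair, pi1_pair. now destruct u.
Qed.

(* The question (t, a, k, c) in EI, where a is read off the triple t. *)
Definition query_at (t k c : nat) : nat := <<t, <<pi1 t, <<k, c>>>>>>.

Definition query_program (t k c : program) : program :=
  Comp Query (Pair t (Pair (Comp Fst t) (Pair k c))).

(* Inputs are [<<n, y>>] with [n] a pair of triples and [y = <<k, <<c0, c1>>>>]
   a candidate for the common codomain and the two images. *)
Definition joint_query : program :=
  Comp nand
    (Pair (query_program (Comp Fst Fst) (Comp Fst Snd) (Comp Fst (Comp Snd Snd)))
          (query_program (Comp Snd Fst) (Comp Fst Snd) (Comp Snd (Comp Snd Snd)))).

Definition joint_output : program :=
  Pair (Pair (Comp Fst Fst) (Pair (Comp Fst Snd) (Comp Fst (Comp Snd Snd))))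
       (Pair (Comp Snd Fst) (Pair (Comp Fst Snd) (Comp Snd (Comp Snd Snd)))).

Definition joint_search : program := Comp joint_output (Pair identity (Mu joint_query)).

Definition joint_spec (n y : nat) : Prop :=
  O (query_at (pi1 n) (pi1 y) (pi1 (pi2 y))) /\
  O (query_at (pi2 n) (pi1 y) (pi2 (pi2 y))).

Definition joint_value (n y : nat) : nat :=
  << <<pi1 n, <<pi1 y, pi1 (pi2 y)>>>>, <<pi2 n, <<pi1 y, pi2 (pi2 y)>>>> >>.

Ltac solve_computes :=
  repeat first [apply computes_pair | apply computes_comp | eassumption
               | exact computes_fst | exact computes_snd | exact computes_query].

Lemma computes_joint_query :
  exists g, computes joint_query g /\ forall n y, g <<n, y>> = 0 <-> joint_spec n y.
Proof.
destruct computes_nand as (h & Hh & Hnand).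
(* [g] is left open and assembled by unification along the program. *)
eexists. split.
- unfold joint_query, query_program. solve_computes.
- intros n y. cbn beta. rewrite Hnand, pi1_pair, pi2_pair.
  unfold joint_spec, oracle_char, query_at.
  destruct (excluded_middle_informative _), (excluded_middle_informative _);
    intuition discriminate.
Qed.

Lemma eval_joint_search n m :
  eval O joint_search n m <->
  exists y, joint_spec n y /\ (forall y', y' < y -> ~ joint_spec n y') /\
    m = joint_value n y.
Proof.
destruct computes_joint_query as (g & Hg & Hspec).
assert (Hmu : forall y, eval O (Mu joint_query) n y <->
    joint_spec n y /\ forall y', y' < y -> ~ joint_spec n y').
{ intros y. rewrite (eval_mu n y Hg), Hspec.
  split; intros [H H']; (split; [exact H|]); intros y' Hy' E;
    now apply (H' y' Hy'), Hspec. }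
assert (Hout : computes joint_output (fun x => joint_value (pi1 x) (pi2 x))).
{ unfold joint_output, joint_value. solve_computes. }
change (eval O joint_search n m) with
  (exists z, (exists u y, eval O identity n u /\ eval O (Mu joint_query) n y /\
     z = <<u, y>>) /\ eval O joint_output z m).
split.
- intros (z & (u & y & Hu & Hy & ->) & Hm).
  apply computes_identity in Hu as ->. apply Hout in Hm.
  rewrite pi1_pair, pi2_pair in Hm. apply Hmu in Hy. exists y. tauto.
- intros (y & Hy & Hmin & ->). exists <<n, y>>. split.
  + exists n, y. split; [now apply computes_identity|]. split; [now apply Hmu|easy].
  + apply Hout. now rewrite pi1_pair, pi2_pair.
Qed.

(** The output depends only on the least witness, and two least witnesses coincide. *)
Lemma joint_search_functional n m m' :
  eval O joint_search n m -> eval O joint_search n m' -> m = m'.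
Proof.
rewrite !eval_joint_search. intros (y & Hy & Hmin & ->) (y' & Hy' & Hmin' & ->).
destruct (Nat.lt_trichotomy y y') as [H|[->|H]]; [|easy|].
- now destruct (Hmin' y H).
- now destruct (Hmin y' H).
Qed.

Lemma joint_search_halts n y : joint_spec n y -> exists m, eval O joint_search n m.
Proof.
intros Hy.
destruct (dec_inh_nat_subset_has_unique_least_element (joint_spec n))
  as (y0 & [Hy0 Hmin] & _); [intros; apply classic|now exists y|].
exists (joint_value n y0). apply eval_joint_search. exists y0. split; [easy|].
split; [|easy]. intros y' Hlt Hy'. apply (Nat.lt_irrefl y').
exact (Nat.lt_le_trans _ _ _ Hlt (Hmin y' Hy')).
Qed.

End Programs.

(** * Embeddings and atomic formulas *)

Section Structures.
Variable L : language.

Lemma embedding_compose (A B C : structure L) (g : B -> C) (h : A -> B) :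
  embedding g -> embedding h -> embedding (fun x => g (h x)).
Proof.
intros (Ig & Rg & Fg) (Ih & Rh & Fh). split; [|split].
- intros x y E. now apply Ih, Ig.
- intros R v. rewrite (Rh R v), (Rg R), Vector.map_map. easy.
- intros F v. rewrite Fh, Fg, Vector.map_map. easy.
Qed.

Lemma value_embedding (A B : structure L) (h : A -> B) n (a : Vector.t A n)
    (t : term L n) :
  embedding h -> value (Vector.map h a) t = h (value a t).
Proof.
(* Terms are nested inside vectors: the recursion on terms needs an inner induction on the
   arguments. *)
intros (_ & _ & Hf). revert t. fix IH 1. intros [i|F ts]; cbn.
- now apply Vector.nth_map.
- rewrite Hf. f_equal.
  induction ts as [|t k ts IHts]; cbn; [easy|]. now rewrite IH, IHts.
Qed.

Lemma sat_embedding (A B : structure L) (h : A -> B) n (a : Vector.t A n)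
    (phi : atomic L n) :
  embedding h -> sat a phi <-> sat (Vector.map h a) phi.
Proof.
intros Hh. destruct phi as [s t|R ts]; cbn.
- rewrite !(value_embedding _ _ Hh). split; [now intros ->|apply Hh].
- rewrite (proj1 (proj2 Hh) R), Vector.map_map.
  rewrite (Vector.map_ext _ _ _ _ (fun t => value_embedding a t Hh)). easy.
Qed.

Lemma simeq_map (A B : structure L) (h : A -> B) (a : list A) :
  embedding h -> simeq a (map h a).
Proof.
intros Hh. exists (length a), (Vector.of_list a), (Vector.map h (Vector.of_list a)).
rewrite Vector.to_list_map, Vector.to_list_of_list_opp.
split; [easy|]. split; [easy|]. intros phi. now apply sat_embedding.
Qed.

Lemma code_tuple_inj (A : nat_structure L) (a b : list A) :
  code_tuple a = code_tuple b -> a = b.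
Proof.
intros H. apply code_list_inj in H. revert b H.
induction a as [|[x Hx] a IH]; intros [|[y Hy] b]; cbn; try discriminate; auto.
intros H. injection H as -> H. f_equal; [|now apply IH].
(* Membership proofs are equalities of booleans, hence unique. *)
f_equal. apply UIP_dec, Bool.bool_dec.
Qed.

(** * Codes of triples and embedding information *)

Variables (K : age L) (KK : computable_age K).

Lemma code_triple_inj k l : code_triple (II KK k) = code_triple (II KK l) -> k = l.
Proof.
intros H. apply pair_inj in H as [_ H]. apply pair_inj in H as [_ H].
now rewrite !II_number in H.
Qed.

(** The first component of the code of a triple codes its generating tuple, and coding of tuples is
    injective, so the second entry of the query can only be the generators. *)
Lemma EI_query t k c :
  EI KK (query_at t k c) <->
  exists l i (b : list (tr_structure (II KK i))),
    t = code_triple (II KK l) /\ k = code_triple (II KK i) /\ c = code_tuple b /\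
    simeq (tr_tuple (II KK l)) b.
Proof.
unfold query_at. split.
- intros (l & i & a & b & H & Hs). exists l, i, b.
  apply pair_inj in H as [-> H]. apply pair_inj in H as [Ha H].
  apply pair_inj in H as [-> ->]. unfold code_triple in Ha. rewrite pi1_pair in Ha.
  now apply code_tuple_inj in Ha as ->.
- intros (l & i & b & -> & -> & -> & Hs). exists l, i, (tr_tuple (II KK l)), b.
  split; [|easy]. unfold code_triple at 2. now rewrite pi1_pair.
Qed.

Lemma joint_spec_EI n y :
  joint_spec (EI KK) n y <->
  exists l0 l1 i (b0 b1 : list (tr_structure (II KK i))),
    n = <<code_triple (II KK l0), code_triple (II KK l1)>> /\
    y = <<code_triple (II KK i), <<code_tuple b0, code_tuple b1>>>> /\
    simeq (tr_tuple (II KK l0)) b0 /\ simeq (tr_tuple (II KK l1)) b1.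
Proof.
unfold joint_spec. rewrite !EI_query. split.
- intros [(l0 & i & b0 & Hn0 & Hi & Hb0 & H0) (l1 & j & b1 & Hn1 & Hj & Hb1 & H1)].
  (* Both queries name the same codomain code [pi1 y]. *)
  assert (i = j) as <- by (apply code_triple_inj; congruence).
  exists l0, l1, i, b0, b1. rewrite <- Hn0, <- Hn1, <- Hi, <- Hb0, <- Hb1.
  now rewrite !pair_pi.
- intros (l0 & l1 & i & b0 & b1 & -> & -> & H0 & H1).
  rewrite !pi2_pair, !pi1_pair. split; [exists l0, i, b0|exists l1, i, b1]; easy.
Qed.

Lemma joint_spec_exists l0 l1 :
  JEP K ->
  exists y, joint_spec (EI KK) <<code_triple (II KK l0), code_triple (II KK l1)>> y.
Proof.
intros HJ.
destruct (HJ _ _ (II_in_age KK l0) (II_in_age KK l1)) as (C & HC & (h0 & H0) & (h1 & H1)).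
(* The amalgam [C] need not be a listed structure; composing with [g] moves both embeddings into one
   that is. *)
destruct (II_complete KK HC) as (i & g & Hg & _).
pose (b0 := map (fun x => g (h0 x)) (tr_tuple (II KK l0))).
pose (b1 := map (fun x => g (h1 x)) (tr_tuple (II KK l1))).
exists <<code_triple (II KK i),
  <<code_tuple (A := tr_structure (II KK i)) b0, code_tuple (A := tr_structure (II KK i)) b1>>>>.
apply joint_spec_EI. exists l0, l1, i, b0, b1.
split; [easy|]. split; [easy|]. split; apply simeq_map; now apply embedding_compose.
Qed.

(** * Correctness of the search *)

Definition joint_embedding (t : triple L * triple L)
    (F : potential_embedding L * potential_embedding L) : Prop :=
  is_embedding_in KK (fst F) /\ is_embedding_in KK (snd F) /\
  dom (fst F) = fst t /\ dom (snd F) = snd t /\ codom (fst F) = codom (snd F).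

Lemma joint_search_sound n m :
  eval (EI KK) joint_search n m ->
  exists l0 l1 F,
    n = <<code_triple (II KK l0), code_triple (II KK l1)>> /\
    m = <<code_potential_embedding (fst F), code_potential_embedding (snd F)>> /\
    joint_embedding (II KK l0, II KK l1) F.
Proof.
intros H. apply eval_joint_search in H as (y & Hy & _ & ->).
apply joint_spec_EI in Hy as (l0 & l1 & i & b0 & b1 & -> & -> & H0 & H1).
exists l0, l1, (PotentialEmbedding (II KK l0) b0, PotentialEmbedding (II KK l1) b1).
split; [easy|]. split.
- unfold joint_value. now rewrite !pi2_pair, !pi1_pair.
- unfold joint_embedding, is_embedding_in, member. cbn. eauto 20.
Qed.

Lemma joint_search_complete l0 l1 :
  JEP K ->
  exists F, joint_embedding (II KK l0, II KK l1) F /\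
    eval (EI KK) joint_search <<code_triple (II KK l0), code_triple (II KK l1)>>
      <<code_potential_embedding (fst F), code_potential_embedding (snd F)>>.
Proof.
intros HJ. destruct (joint_spec_exists l0 l1 HJ) as [y Hy].
destruct (joint_search_halts Hy) as [m Hm].
destruct (joint_search_sound Hm) as (k0 & k1 & F & Hn & -> & HF).
(* Soundness returns its own indices [k0], [k1]; equal codes force them to be [l0], [l1]. *)
apply pair_inj in Hn as [E0 E1].
apply code_triple_inj in E0 as <-. apply code_triple_inj in E1 as <-. now exists F.
Qed.

End Structures.

Theorem proposition5p20 (L : language) (K : age L) (KK : computable_age K)
    (hJEP : JEP K) :
  computable_JEP KK (EI KK).
Proof.
(* [F] is tied to the output of the search, so that the [f] obtained by choice is the function the
   program computes; arbitrary joint embeddings need not be. *)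
assert (Hf : forall t : triple L * triple L, exists F,
    member KK (fst t) /\ member KK (snd t) ->
    joint_embedding KK t F /\
    eval (EI KK) joint_search <<code_triple (fst t), code_triple (snd t)>>
      <<code_potential_embedding (fst F), code_potential_embedding (snd F)>>).
{ intros [t0 t1].
  destruct (classic (member KK t0 /\ member KK t1)) as [[[l0 ->] [l1 ->]]|Ht].
  - destruct (joint_search_complete KK l0 l1 hJEP) as [F HF]. now exists F.
  (* A default value outside the domain. *)
  - exists (@PotentialEmbedding L t0 t0 nil, @PotentialEmbedding L t0 t0 nil). tauto. }
apply functional_choice in Hf as [f Hf].
assert (HII : forall l0 l1,
    member KK (fst (II KK l0, II KK l1)) /\ member KK (snd (II KK l0, II KK l1))).
{ intros l0 l1. split; [now exists l0|now exists l1]. }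
exists f. split.
- exists joint_search. intros n m. split.
  (* Halting forces the input to code a pair of members; single-valuedness then identifies [m] with
     the code of the value of [f]. *)
  + intros Hm. destruct (joint_search_sound Hm) as (l0 & l1 & F & -> & _).
    exists (II KK l0, II KK l1). split; [apply HII|]. split; [easy|].
    exact (joint_search_functional (proj2 (Hf _ (HII l0 l1))) Hm).
  + intros (t & Ht & <- & <-). now apply Hf.
- intros l0 l1. exists (fst (f (II KK l0, II KK l1))), (snd (f (II KK l0, II KK l1))).
  split; [apply surjective_pairing|]. exact (proj1 (Hf _ (HII l0 l1))).
Qed.
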